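(* The Hilbert polynomial and the Hilbert series of $R^{\overline{D_{2d}}}$ are: (i) $\displaystyle \mathrm{HP}(R^{\overline{D_{2d}}},t)=\frac12\bigl(2dt^2+(d+\gcd(d,2)+2)t+2\bigr)$; (ii) $\displaystyle \mathrm{HS}(R^{\overline{D_{2d}}},z)=\frac{1}{(1-z)^3}\left(\frac{d-\gcd(d,2)}{2}z^2+\frac{3d+\gcd(d,2)-2}{2}z+1\right).$
   Context: Let $k$ be an algebraically closed field of characteristic zero and $R=k[x_0,x_1,x_2]$ with its standard grading. Fix integers $d\ge 3$ and $0<a<\frac d2$ with $\gcd(a,d)=1$, a primitive $2d$-th root of unity $\varepsilon\in k$, and set $e=\varepsilon^2$. The dihedral group $D_{2d}=\langle \tau,\eta \mid \tau^d=\eta^2=(\eta\tau)^2=1\rangle$ of order $2d$ acts linearly on $R$ through the representation $\rho_a:D_{2d}\to \mathrm{GL}(3,k)$ with $\rho_a(\tau)=\mathrm{diag}(1,e^a,e^{d-a})$ and $\rho_a(\eta)$ the permutation matrix fixing $x_0$ and interchanging $x_1$ and $x_2$. Identify $D_{2d}$ with its image. Let $C_{2d}=\langle\varepsilon\,\mathrm{Id}\rangle$ and let $\overline{D_{2d}}=D_{2d}\times C_{2d}\subset \mathrm{GL}(3,k)$ be the subgroup generated by $D_{2d}$ and $C_{2d}$. The ring of invariants $R^{\overline{D_{2d}}}$ is graded by $R^{\overline{D_{2d}}}=\bigoplus_{t\ge0}R^{\overline{D_{2d}}}_t$ with $R^{\overline{D_{2d}}}_t:=R_{2dt}\cap R^{D_{2d}}$.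 With respect to this grading, $\mathrm{HS}(R^{\overline{D_{2d}}},z)=\sum_{t\ge0}\dim_k(R^{\overline{D_{2d}}}_t)z^t$ and $\mathrm{HP}(R^{\overline{D_{2d}}},t)$ is the polynomial agreeing with $\dim_k R^{\overline{D_{2d}}}_t$ for all $t\gg0$. *)

(* Defs.v *)
From HB Require Import structures.
From mathcomp Require Import all_boot all_order all_fingroup all_algebra.
From mathcomp Require Import mpoly.
From mathcomp Require Import boolp classical_sets.

Set Implicit Arguments.
Unset Strict Implicit.
Unset Printing Implicit Defensive.

Import GRing.Theory Num.Theory.
Local Open Scope ring_scope.

Section MatrixGroups.
Variables (k : fieldType) (n : nat).

(* Subgroup of GL(n, k) generated by a set [S] of invertible matrices. *)
Inductive mxgen (S : 'M[k]_n -> Prop) : 'M[k]_n -> Prop :=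
| mxgen_sub A : S A -> mxgen S A
| mxgen_one : mxgen S 1%:M
| mxgen_mul A B : mxgen S A -> mxgen S B -> mxgen S (A *m B)
| mxgen_inv A : mxgen S A -> mxgen S (invmx A).

(* Left action of GL(n, k) on k[x_0, ..., x_(n-1)] by linear substitution: the
   matrix [g] sends x_j to the linear form given by its j-th column. *)
Definition mxact (g : 'M[k]_n) (p : {mpoly k[n]}) : {mpoly k[n]} :=
  p \mPo [tuple \sum_(i < n) g i j *: 'X_i | j < n].

Definition invariant (G : 'M[k]_n -> Prop) (p : {mpoly k[n]}) : Prop :=
  forall g, G g -> mxact g p = p.

Lemma mxact1 p : mxact 1%:M p = p.
Proof.
rewrite -[RHS]comp_mpoly_id; congr (_ \mPo _).
apply: eq_from_tnth => j; rewrite !tnth_mktuple (bigD1 j) //= big1 => [|i ij].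
  by rewrite !mxE eqxx scale1r addr0.
by rewrite !mxE (negbTE ij) scale0r.
Qed.

Lemma mxact_linear g : linear (mxact g).
Proof. by move=> c p q; rewrite /mxact linearP. Qed.

Lemma mxactXU g j : mxact g 'X_j = \sum_(i < n) g i j *: 'X_i.
Proof. by rewrite /mxact comp_mpolyXU -tnth_nth tnth_mktuple. Qed.

Lemma mxactM A B p : mxact (A *m B) p = mxact A (mxact B p).
Proof.
rewrite /mxact [p \mPo _]comp_mpolyEX [p \mPo _ in RHS]comp_mpolyEX linear_sum.
apply: eq_bigr => m _; rewrite linearZ /=; congr (_ *: _).
rewrite !comp_mpolyX rmorph_prod /=; apply: eq_bigr => j _.
rewrite rmorphXn /= !tnth_mktuple; congr (_ ^+ _); rewrite linear_sum /=.
transitivity (\sum_(l < n) \sum_(i < n) (B l j * A i l) *: ('X_i : {mpoly k[n]})).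
  rewrite exchange_big /=; apply: eq_bigr => i _; rewrite mxE scaler_suml.
  by apply: eq_bigr => l _; rewrite mulrC.
apply: eq_bigr => l _; rewrite linearZ /= comp_mpolyXU -tnth_nth tnth_mktuple.
by rewrite scaler_sumr; apply: eq_bigr => i _; rewrite scalerA.
Qed.

Lemma invariant_mxgen S p : invariant (mxgen S) p <-> invariant S p.
Proof.
split=> [Sp g Sg|Sp g]; first by apply: Sp; apply: mxgen_sub.
elim=> {g} [A /Sp //| |A B _ pA _ pB|A _ pA]; first exact: mxact1.
  by rewrite mxactM pB pA.
case: (boolP (A \in unitmx)) => [uA|nA]; last by rewrite invmx_out.
by rewrite -[in LHS]pA -mxactM mulVmx // mxact1.
Qed.

Lemma mcoeff_mxact_scalar c p m :
  (mxact c%:M p)@_m = c ^+ mdeg m * p@_m.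
Proof.
rewrite /mxact comp_mpolyEX [in RHS](mpolyE p) !raddf_sum /= mulr_sumr.
apply: eq_bigr => m' _; rewrite !mcoeffZ mulrCA; congr (_ * _).
have -> : 'X_[m'] \mPo [tuple \sum_(i < n) (c%:M : 'M_n) i j *: 'X_i | j < n]
          = c ^+ mdeg m' *: 'X_[k, m'] :> {mpoly k[n]}.
  rewrite comp_mpolyX mpolyXE_id mdegE -prodrXr -scaler_prod.
  apply: eq_bigr => j _; rewrite tnth_mktuple -exprZn; congr (_ ^+ _).
  rewrite (bigD1 j) //= big1 => [|i ij]; first by rewrite mxE eqxx addr0.
  by rewrite mxE (negbTE ij) scale0r.
by rewrite mcoeffZ mcoeffX; case: eqP => [->//|_]; rewrite !mulr0.
Qed.

End MatrixGroups.

(* The subspace of [V] whose elements are those satisfying [W]; it is the zero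
   subspace if [W] is not closed under linear combinations. *)
Definition vspace_of (k : fieldType) (V : vectType k) (W : V -> Prop) :
  {vspace V} := xget 0%VS [set U | forall v, v \in U <-> W v]%classic.

Lemma vspace_ofP (k : fieldType) (V : vectType k) (W : V -> Prop) :
  W 0 -> (forall c u v, W u -> W v -> W (c *: u + v)) ->
  forall v, v \in vspace_of W <-> W v.
Proof.
move=> W0 Wlin.
suff [U WU] : exists U : {vspace V}, forall v, v \in U <-> W v.
  by rewrite /vspace_of; case: xgetP => [U' _ //|/(_ U)/(_ WU)].
pose P m := `[< exists U : {vspace V}, \dim U = m /\ forall v, v \in U -> W v >].
have exP : exists m, P m.
  by exists 0%N; apply/asboolP; exists 0%VS; rewrite dimv0; split=> // v;
    rewrite memv0 => /eqP ->.
have ubP m : P m -> (m <= \dim {:V})%N.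
  by move=> /asboolP [U [<- _]]; apply: dimvS; apply: subvf.
case: (ex_maxnP exP ubP) => m /asboolP [U [dU UW]] maxm; exists U => v.
split=> [/UW //|Wv].
have /maxm : P (\dim (U + <[v]>)%VS).
  apply/asboolP; exists (U + <[v]>)%VS; split=> // w.
  move=> /memv_addP [u uU [w' /vlineP [c ->] ->]].
  by rewrite addrC; apply: Wlin => //; apply: UW.
rewrite -dU => leU; have : (U == U + <[v]>)%VS by rewrite eqEdim addvSl.
by move=> /eqP ->; apply: (subvP (addvSr _ _)); apply: memv_line.
Qed.

Section Dihedral.
Variables (k : fieldType) (d a : nat) (eps : k).

Let e : k := eps ^+ 2.

Definition rho_tau : 'M[k]_3 :=
  diag_mx (\row_(j < 3) [:: 1; e ^+ a; e ^+ (d - a)]`_j).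

Definition rho_eta : 'M[k]_3 := perm_mx (tperm (1 : 'I_3) (2 : 'I_3)).

(* The image of the dihedral group of order 2d under the representation. *)
Definition D2d : 'M[k]_3 -> Prop :=
  mxgen (fun A => A = rho_tau \/ A = rho_eta).

Definition C2d : 'M[k]_3 -> Prop := mxgen (fun A => A = eps%:M).

Definition D2d_bar : 'M[k]_3 -> Prop := mxgen (fun A => D2d A \/ C2d A).

(* The degree-t piece of the invariant ring of D2d_bar: the polynomials
   homogeneous of degree 2dt that are invariant under D2d. *)
Definition inv_piece (t : nat) : {vspace dhomog 3 k (2 * d * t)} :=
  vspace_of (fun p : dhomog 3 k (2 * d * t) => invariant D2d (val p)).

Lemma mem_inv_piece t (p : dhomog 3 k (2 * d * t)) :
  p \in inv_piece t <-> invariant D2d (val p).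
Proof.
apply: (vspace_ofP (W := fun p : dhomog 3 k (2 * d * t) => _)) => [g _|].
  by rewrite linear0 /mxact linear0.
move=> c u v Wu Wv g Dg.
by rewrite linearP /= mxact_linear Wu // Wv.
Qed.

(* The ring of invariants of D2d_bar is the direct sum of the pieces above. *)
Lemma invariant_D2d_bar p : (2 * d).-primitive_root eps ->
  invariant D2d_bar p <->
  invariant D2d p /\ {in msupp p, forall m, (2 * d %| mdeg m)%N}.
Proof.
move=> pr; split=> [/invariant_mxgen pD|[pD pm]]; last first.
  apply/invariant_mxgen => g [/pD //|]; move: g.
  apply/invariant_mxgen => _ ->; apply/mpolyP => m; rewrite mcoeff_mxact_scalar.
  case: (boolP (m \in msupp p)) => [/pm dm|/memN_msupp_eq0 ->].
    by rewrite (eqP (_ : eps ^+ mdeg m == 1)) ?mul1r // -(prim_order_dvd pr).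
  by rewrite mulr0.
split=> [g Dg|m]; first by apply: pD; left.
rewrite mcoeff_msupp (prim_order_dvd pr) => pm.
have /(congr1 (mcoeff m)) : mxact eps%:M p = p.
  by apply: pD; right; apply: mxgen_sub.
rewrite mcoeff_mxact_scalar => /eqP.
by rewrite -subr_eq0 -{2}[p@_m]mul1r -mulrBl mulf_eq0 (negbTE pm) orbF subr_eq0.
Qed.

Definition hilbert_fun (t : nat) : nat := \dim (inv_piece t).

(* Formal power series over rat are represented by their coefficient
   sequences. *)
Definition hilbert_series : nat -> rat := fun t => (hilbert_fun t)%:R.

End Dihedral.

Definition fps_mul (f g : nat -> rat) : nat -> rat :=
  fun n => \sum_(i < n.+1) f i * g (n - i)%N.

Definition fps_of_poly (p : {poly rat}) : nat -> rat := fun n => p`_n.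

(* [f] is the expansion in Q[[z]] of the rational function p / q, where q is a
   unit of Q[[z]]. *)
Definition fps_is_fraction (f : nat -> rat) (p q : {poly rat}) : Prop :=
  q`_0 != 0 /\ fps_mul (fps_of_poly q) f =1 fps_of_poly p.

Definition is_hilbert_poly (h : nat -> nat) (P : {poly rat}) : Prop :=
  exists t0, forall t, (t0 <= t)%N -> (h t)%:R = P.[t%:R].

Lemma is_hilbert_poly_uniq h P Q :
  is_hilbert_poly h P -> is_hilbert_poly h Q -> P = Q.
Proof.
move=> [s hP] [t hQ]; apply/eqP; rewrite -subr_eq0; apply/negPn/negP => nz.
pose r := [seq (i%:R : rat) | i <- iota (s + t) (size (P - Q))].
have := max_poly_roots (rs := r) nz; rewrite size_map size_iota ltnn.
have -> : uniq r.
  by rewrite map_inj_uniq ?iota_uniq // => i j /eqP; rewrite eqr_nat => /eqP.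
have -> : all (root (P - Q)) r; last by move=> /(_ isT isT).
apply/allP => _ /mapP [i + ->]; rewrite mem_iota => /andP [lei _].
rewrite rootE hornerD hornerN -hP ?(leq_trans (leq_addr _ _) lei) //.
by rewrite -hQ ?subrr // (leq_trans (leq_addl _ _) lei).
Qed.

(* Main.v *)
Require Import Defs.
From HB Require Import structures.
From mathcomp Require Import all_boot all_order all_algebra.
From mathcomp Require Import all_fingroup mpoly zify lra.

(** Everything happens at the level of monomials.  The matrix rho_tau is
diagonal, so it multiplies x_0^u x_1^v x_2^w by e^(a v + (d - a) w), and as e
has order d and a is prime to d this factor is 1 exactly when v = w mod d.  The
matrix rho_eta permutes the monomials by exchanging v and w.  Hence a polynomial
is invariant under the dihedral group iff its support lies in v = w mod d and
its coefficients are unchanged by v <-> w ([invariant_D2dP]).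

The invariants of degree 2dt therefore have as a basis the orbit sums of the
monomials with w <= v and v = w mod d.  Writing v = w + j d, the exponent of
x_0 is (2t - j) d - 2 w; with i = 2t - j running over 0, ..., 2t this leaves the
choices 0 <= w <= i d / 2.  Reading off the coefficients at these
representatives identifies the space of invariants with a coordinate space
([hilbert_funE]):
  dim = sum_(0 <= i <= 2t) (floor (i d / 2) + 1).
Adding two terms at a time as t grows, a single term of odd index loses 1/2 when
d is odd, which is where gcd(d, 2) comes from; one obtains that
  2 dim = 2 d t^2 + (d + gcd(d, 2) + 2) t + 2
for every t >= 0 ([hilbert_sumE]), not only for large t.  Thus the Hilbert
function coincides with the Hilbert polynomial everywhere; since it is quadratic
its third differences vanish, and (1 - z)^3 times its generating series is the
polynomial given by the first three of them. *)

Set Implicit Arguments.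
Unset Strict Implicit.
Unset Printing Implicit Defensive.

Import GRing.Theory.
Local Open Scope ring_scope.

(** * Dimension of a subspace from coordinates *)

Lemma dim_linear_bij (k : fieldType) (V : vectType k) (U : {vspace V}) (n : nat)
    (f : {linear V -> 'rV[k]_n}) :
  (forall u, u \in U -> f u = 0 -> u = 0) ->
  (forall r, exists2 u, u \in U & f u = r) ->
  \dim U = n.
Proof.
move=> f_inj f_surj; rewrite -(@limg_dim_eq _ _ _ (linfun f)); last first.
  apply/eqP; rewrite -subv0; apply/subvP => u.
  rewrite memv_cap memv_ker lfunE memv0 => /andP [uU /eqP fu0].
  by rewrite (f_inj u).
suff -> : (linfun f @: U)%VS = fullv by rewrite dimvf /dim /= mul1n.
apply/eqP; rewrite eqEsubv subvf; apply/subvP => r _.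
by have [u uU <-] := f_surj r; rewrite -lfunE memv_img.
Qed.

(** * Diagonal and permutation matrices acting on polynomials *)

Section CoefficientsOfAction.
Variables (k : fieldType) (n : nat).
Implicit Types (p : {mpoly k[n]}) (m : 'X_{1..n}).

(** Monomials are eigenvectors of a diagonal matrix, the eigenvalue being the
monomial evaluated at the diagonal. *)
Lemma mcoeff_mxact_diag (r : 'rV[k]_n) p m :
  (mxact (diag_mx r) p)@_m = (\prod_(i < n) r 0 i ^+ m i) * p@_m.
Proof.
rewrite /mxact comp_mpolyEX [in RHS](mpolyE p) !raddf_sum /= mulr_sumr.
apply: eq_bigr => m' _; rewrite !mcoeffZ mulrCA; congr (_ * _).
have -> : 'X_[m'] \mPo [tuple \sum_(i < n) diag_mx r i j *: 'X_i | j < n]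
          = (\prod_(i < n) r 0 i ^+ m' i) *: 'X_[k, m'] :> {mpoly k[n]}.
  rewrite comp_mpolyX mpolyXE_id -scaler_prod.
  apply: eq_bigr => j _; rewrite tnth_mktuple -exprZn; congr (_ ^+ _).
  rewrite (bigD1 j) //= big1 => [|i ij]; first by rewrite !mxE eqxx addr0.
  by rewrite mxE (negbTE ij) scale0r.
by rewrite mcoeffZ mcoeffX; case: eqP => [->//|_]; rewrite !mulr0.
Qed.

(** The inverse appears because the variable x_j is sent to the j-th column of
the matrix, whose only nonzero entry is in row s^-1 j. *)
Lemma mxact_perm (s : 'S_n) p : mxact (perm_mx s) p = msym s^-1%g p.
Proof.
apply: eq_bigr => m _; congr (_ * _); apply: eq_bigr => j _; congr (_ ^+ _).
rewrite tnth_mktuple (bigD1 (s^-1%g j)) //= big1 => [|i ij].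
  by rewrite !mxE permKV eqxx scale1r addr0.
by rewrite !mxE -(inj_eq (@perm_inj _ s^-1%g)) permK (negbTE ij) scale0r.
Qed.

End CoefficientsOfAction.

(** * Monomials in three variables *)

Lemma big_ord3 (T : Type) (idx : T) (op : Monoid.law idx) (F : 'I_3 -> T) :
  \big[op/idx]_(i < 3) F i = op (F 0) (op (F 1) (F 2)).
Proof.
rewrite !big_ord_recl big_ord0 Monoid.mulm1.
by congr (op (F _) (op (F _) (F _))); apply: val_inj.
Qed.

Lemma mnmP3 (m m' : 'X_{1..3}) :
  m 0 = m' 0 -> m 1 = m' 1 -> m 2 = m' 2 -> m = m'.
Proof.
move=> e0 e1 e2; apply/mnmP => -[[|[|[|//]]] lti].
- by have -> : Ordinal lti = 0 by apply: val_inj.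
- by have -> : Ordinal lti = 1 by apply: val_inj.
by have -> : Ordinal lti = 2 by apply: val_inj.
Qed.

Lemma mdeg3 (m : 'X_{1..3}) : mdeg m = (m 0%R + (m 1%R + m 2%R))%N.
Proof. by rewrite mdegE big_ord3. Qed.

Definition mswap (m : 'X_{1..3}) : 'X_{1..3} :=
  [multinom m (tperm (1%R : 'I_3) (2%R : 'I_3) i) | i < 3].

Lemma mswapK : involutive mswap.
Proof. by move=> m; apply/mnmP => i; rewrite !mnmE tpermK. Qed.

Lemma mswap0 m : mswap m 0 = m 0.
Proof. by rewrite mnmE tpermD. Qed.

Lemma mswap1 m : mswap m 1 = m 2.
Proof. by rewrite mnmE tpermL. Qed.

Lemma mswap2 m : mswap m 2 = m 1.
Proof. by rewrite mnmE tpermR. Qed.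

Lemma mdeg_mswap m : mdeg (mswap m) = mdeg m.
Proof. exact: mdeg_mperm. Qed.

Definition orbit_sum (k : fieldType) (m : 'X_{1..3}) : {mpoly k[3]} :=
  if mswap m == m then 'X_[m] else 'X_[m] + 'X_[mswap m].

(** All coefficients are 0 or 1, in any characteristic: this is why the orbit
sum of a symmetric monomial is that monomial and not its double. *)
Lemma mcoeff_orbit_sum (k : fieldType) m m' :
  (orbit_sum k m)@_m' = ((m' == m) || (m' == mswap m))%:R.
Proof.
rewrite /orbit_sum; have [fix_m|] := eqVneq.
  by rewrite mcoeffX fix_m orbb eq_sym.
rewrite mcoeffD !mcoeffX ![_ == m']eq_sym.
have [-> /negPf|_ _] := eqVneq m' m; last by rewrite add0r.
by rewrite eq_sym => ->; rewrite addr0.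
Qed.

(** * Invariant polynomials of the dihedral group *)

Section InvariantPolynomials.
Variables (k : fieldType) (d a : nat) (eps : k).
Hypotheses (lt_ad : (a < d)%N) (co_ad : coprime a d).
Hypothesis prim_eps : (2 * d).-primitive_root eps.

Lemma tau_weight_eq1 (x y : nat) :
  ((eps ^+ 2) ^+ a ^+ x * (eps ^+ 2) ^+ (d - a) ^+ y == 1) =
  (x == y %[mod d]).
Proof.
rewrite -!exprM -exprD -mulnDr -(prim_order_dvd prim_eps) dvdn_pmul2l //.
(* Adding a y on both sides cancels the truncated difference d - a, and the
   condition becomes a x = a y modulo d. *)
rewrite /dvdn -[X in _ == X](mod0n d) -(eqn_modDr (a * y)) add0n.
have -> : (a * x + (d - a) * y + a * y = y * d + a * x)%N.
  by rewrite -addnA -mulnDl subnK 1?ltnW // addnC mulnC.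
rewrite modnMDl.
wlog le_yx : x y / (y <= x)%N => [th|].
  by case/orP: (leq_total x y) => /th //; rewrite eq_sym => ->; rewrite eq_sym.
rewrite !eqn_mod_dvd ?leq_mul2l ?le_yx ?orbT // -mulnBr.
by rewrite Gauss_dvdr // coprime_sym.
Qed.

Lemma mcoeff_mxact_tau p m :
  (mxact (rho_tau d a eps) p)@_m =
  ((eps ^+ 2) ^+ a ^+ m 1 * (eps ^+ 2) ^+ (d - a) ^+ m 2) * p@_m.
Proof. by rewrite mcoeff_mxact_diag big_ord3 !mxE /= expr1n mul1r. Qed.

Lemma mcoeff_mxact_eta p m : (mxact (rho_eta k) p)@_m = p@_(mswap m).
Proof. by rewrite mxact_perm mcoeff_sym tpermV. Qed.

(** It suffices to test the two generators: rho_tau multiplies each coefficient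
by its weight, so only coefficients of weight 1 survive, and rho_eta permutes
the coefficients. *)
Lemma invariant_D2dP (p : {mpoly k[3]}) :
  Defs.invariant (D2d d a eps) p <->
  (forall m, p@_m != 0 -> m 1 = m 2 %[mod d]) /\
  (forall m, p@_(mswap m) = p@_m).
Proof.
split=> [/invariant_mxgen inv|[supp_p sym_p]].
  split=> m; last by rewrite -mcoeff_mxact_eta inv //; right.
  move=> pm; apply/eqP; rewrite -tau_weight_eq1 -subr_eq0.
  rewrite -(mulIr_eq0 _ (mulIf pm)) mulrBl mul1r -mcoeff_mxact_tau inv ?subrr //.
  by left.
apply/invariant_mxgen => _ [|] ->; apply/mpolyP => m.
  rewrite mcoeff_mxact_tau; have [->|/supp_p/eqP] := eqVneq p@_m 0.
    by rewrite mulr0.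
  by rewrite -tau_weight_eq1 => /eqP ->; rewrite mul1r.
by rewrite mcoeff_mxact_eta.
Qed.

End InvariantPolynomials.

(** * Representatives of the orbits of monomials *)

Section Representatives.
Variables (d t : nat).

(** The monomial with exponents v = l + (2t - i) d and w = l of x_1 and x_2;
the exponent of x_0 is what total degree 2dt leaves.  Indexing by i instead of
(v - w) / d = 2t - i makes the number of admissible l depend on i and d only. *)
Definition rep_mon (i l : nat) : 'X_{1..3} :=
  [multinom nth 0 [:: i * d - 2 * l; l + (2 * t - i) * d; l] j | j < 3].

Definition rep_mons : seq 'X_{1..3} :=
  [seq rep_mon i l | i <- iota 0 (2 * t).+1, l <- iota 0 (i * d)./2.+1].

Lemma rep_monE i l :
  [/\ rep_mon i l 0 = (i * d - 2 * l)%N,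
      rep_mon i l 1 = (l + (2 * t - i) * d)%N & rep_mon i l 2 = l].
Proof. by rewrite !mnmE. Qed.

Lemma mem_rep_mons m : (0 < d)%N ->
  m \in rep_mons <->
  [/\ mdeg m = (2 * d * t)%N, m 1 = m 2 %[mod d] & (m 2%R <= m 1%R)%N].
Proof.
move=> d_gt0.
rewrite mdeg3; split=> [/allpairsPdep [i [l []]]|[deg_m /eqP eq_m le_m]].
  rewrite !mem_iota !ltnS => /= le_i le_l ->.
  have [-> -> ->] := rep_monE i l; split; last exact: leq_addr.
    have le_li : (2 * l <= i * d)%N by lia.
    nia.
  by rewrite addnC modnMDl.
move: eq_m; rewrite eqn_mod_dvd // => /dvdnP [j def_j].
apply/allpairsPdep; exists (2 * t - j)%N, (m 2).
have le_j : (j <= 2 * t)%N by rewrite -(leq_pmul2r d_gt0); nia.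
rewrite !mem_iota; split=> /=; [lia|nia|].
have [e0 e1 e2] := rep_monE (2 * t - j) (m 2).
by apply: mnmP3; rewrite ?e0 ?e1 ?e2 //; nia.
Qed.

Lemma uniq_rep_mons : (0 < d)%N -> uniq rep_mons.
Proof.
move=> d_gt0; apply: allpairs_uniq_dep => [|i _|]; try exact: iota_uniq.
move=> _ _ /allpairsPdep [i [l [+ _ ->]]] /allpairsPdep [j [l' [+ _ ->]]] /=.
rewrite !mem_iota /= !ltnS => le_i le_j eq_m.
have [_ i1 i2] := rep_monE i l; have [_ j1 j2] := rep_monE j l'.
have eq_l : l = l' by rewrite -i2 -j2 eq_m.
have /eqP : ((2 * t - i) * d = (2 * t - j) * d)%N.
  by apply: (@addnI l); rewrite -i1 eq_m j1 eq_l.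
rewrite eqn_pmul2r // => /eqP eq_ij; have -> : i = j by lia.
by rewrite eq_l.
Qed.

Lemma size_rep_mons :
  size rep_mons = (\sum_(i < (2 * t).+1) (i * d)./2.+1)%N.
Proof.
rewrite size_allpairs_dep sumnE big_map -{1}[(2 * t).+1]subn0 -/(index_iota _ _).
by rewrite big_mkord; apply: eq_bigr => i _; rewrite size_iota.
Qed.

End Representatives.

(** * The Hilbert function *)

Section Dimension.
Variables (k : fieldType) (d a : nat) (eps : k).
Hypotheses (lt_ad : (a < d)%N) (co_ad : coprime a d).
Hypothesis prim_eps : (2 * d).-primitive_root eps.

(** The coefficients at the representatives are coordinates on the space of
invariants: they determine an invariant by symmetry, and the orbit sums of the
representatives are the dual basis. *)
Lemma hilbert_funE t :
  hilbert_fun d a eps t = (\sum_(i < (2 * t).+1) (i * d)./2.+1)%N.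
Proof.
have d_gt0 : (0 < d)%N by apply: leq_ltn_trans lt_ad.
rewrite -size_rep_mons; set s := rep_mons d t.
have s_ i : tnth (in_tuple s) i \in s by apply: mem_tnth.
pose coefs (p : dhomog 3 k (2 * d * t)) :=
  \row_(i < size s) (val p)@_(tnth (in_tuple s) i).
have coefs_lin : linear coefs.
  by move=> c p q; apply/rowP => i; rewrite !mxE linearP.
pose coefsL : {linear _ -> _} :=
  HB.pack coefs (GRing.isLinear.Build _ _ _ _ coefs coefs_lin).
apply: (@dim_linear_bij _ _ _ _ coefsL) => [p /mem_inv_piece|r].
  move=> /(invariant_D2dP lt_ad co_ad prim_eps) [supp_p sym_p] /rowP p0.
  apply: val_inj; apply/mpolyP => m; rewrite mcoeff0.
  wlog le_m : m / (m 2%R <= m 1%R)%N => [th|].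
    case/orP: (leq_total (m 2%R) (m 1%R)) => [/th //|le_m].
    by rewrite -sym_p th // mswap1 mswap2.
  apply/eqP/negPn/negP => pm.
  have /tnthP [i def_m] : m \in in_tuple s.
    apply/mem_rep_mons => //; split; rewrite ?supp_p //.
    by apply: (dhomog_mf (valP p)); rewrite mcoeff_msupp.
  by have := p0 i; rewrite !mxE -def_m => /eqP; apply/negP.
pose q : {mpoly k[3]} := \sum_i r 0 i *: orbit_sum k (tnth (in_tuple s) i).
have q_homog : q \is (2 * d * t).-homog.
  apply: rpred_sum => i _; apply: rpredZ; rewrite /orbit_sum.
  have /mem_rep_mons [] // := s_ i => deg_i _ _.
  by case: ifP => _; rewrite ?rpredD ?dhomogX /= ?mdeg_mswap ?deg_i.
exists (DHomog q_homog).
  apply/mem_inv_piece/(invariant_D2dP lt_ad co_ad prim_eps) => /=; split=> m.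
    apply: contraNeq => neq_m; rewrite raddf_sum big1 //= => i _.
    rewrite mcoeffZ mcoeff_orbit_sum.
    have /mem_rep_mons [] // := s_ i => _ eq_i _.
    suff /negPf -> : ~~ ((m == tnth (in_tuple s) i)
                         || (m == mswap (tnth (in_tuple s) i))).
      by rewrite mulr0.
    by apply: contra neq_m => /orP [] /eqP ->; rewrite ?mswap1 ?mswap2 eq_i.
  rewrite !raddf_sum; apply: eq_bigr => i _ /=.
  rewrite !mcoeffZ !mcoeff_orbit_sum.
  by rewrite (can2_eq mswapK mswapK) (inj_eq (inv_inj mswapK)) orbC.
apply/rowP => i; rewrite mxE /= raddf_sum (bigD1 i) //= big1 => [|j neq_ji].
  by rewrite mcoeffZ mcoeff_orbit_sum eqxx mulr1 addr0.
rewrite mcoeffZ mcoeff_orbit_sum.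
have neq_m : tnth (in_tuple s) i != tnth (in_tuple s) j.
  by rewrite (inj_eq (tuple_uniqP _ _)) 1?eq_sym // uniq_rep_mons.
(* Two representatives exchanged by the swap both satisfy w <= v, so they are
   symmetric and equal. *)
rewrite (negPf neq_m) /=; case: eqP => [eq_sw|]; last by rewrite mulr0.
have /mem_rep_mons [] // := s_ i => _ _ le_i.
have /mem_rep_mons [] // := s_ j => _ _ le_j.
case/eqP: neq_m; rewrite eq_sw; rewrite eq_sw mswap1 mswap2 in le_i.
have eq_12 := @anti_leq _ _ (introT andP (conj le_i le_j)).
by apply: mnmP3; rewrite ?mswap0 ?mswap1 ?mswap2 ?eq_12.
Qed.

End Dimension.

(** Passing from t to t + 1 adds the terms of index 2t + 1 and 2t + 2; only the
former is affected by rounding, by 1/2 when d is odd. *)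
Lemma hilbert_sumE d t :
  ((\sum_(i < (2 * t).+1) (i * d)./2.+1)%N.*2 =
   2 * d * t ^ 2 + (d + gcdn d 2 + 2) * t + 2)%N.
Proof.
have def_g : gcdn d 2 = if odd d then 1%N else 2.
  case: ifPn; first by rewrite -coprimen2 => /eqP.
  by move=> even_d; apply/gcdn_idPr; rewrite dvdn2.
elim: t => [|t IHt]; first by rewrite big_ord1 mul0n !muln0.
have -> : (2 * t.+1 = (2 * t).+2)%N by lia.
rewrite big_ord_recr big_ord_recr /=.
have h1 : (((2 * t).+2 * d)./2 = t.+1 * d)%N by lia.
have h2 : (((2 * t).+1 * d)./2.*2 + odd d = (2 * t).+1 * d)%N.
  by rewrite -[RHS]odd_double_half oddM /= oddM addnC.
by rewrite h1 !doubleD IHt def_g; case: (odd d) h2; nia.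
Qed.

(** * The Hilbert polynomial and the Hilbert series *)

Theorem proposition3p4 (k : closedFieldType) (hchar : [pchar k] =i pred0)
    (d a : nat) (hd : (3 <= d)%N) (ha0 : (0 < a)%N) (had : (2 * a < d)%N)
    (hcop : coprime a d) (eps : k) (heps : (2 * d).-primitive_root eps) :
  is_hilbert_poly (hilbert_fun d a eps)
    ((1 / 2) *: ((2 * d)%:R *: 'X^2 + (d + gcdn d 2 + 2)%:R *: 'X + 2%:P)) /\
  fps_is_fraction (hilbert_series d a eps)
    (((d%:R - (gcdn d 2)%:R) / 2) *: 'X^2
     + ((3 * d%:R + (gcdn d 2)%:R - 2) / 2) *: 'X + 1)
    ((1 - 'X) ^+ 3).
Proof.
have lt_ad : (a < d)%N by lia.
have h_val t : (hilbert_fun d a eps t)%:R =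
    (2 * d%:R * t%:R ^+ 2 + (d%:R + (gcdn d 2)%:R + 2) * t%:R + 2) / 2 :> rat.
  rewrite (hilbert_funE lt_ad hcop heps).
  have /(congr1 (fun n => n%:R : rat)) := hilbert_sumE d t.
  by rewrite -mul2n !(natrD, natrM) => eq_2h; lra.
split.
  exists 0%N => t _.
  rewrite h_val !(hornerZ, hornerD, hornerXn, hornerX, hornerC).
  rewrite [(2 * d)%:R]natrM [(d + gcdn d 2 + 2)%:R]natrD.
  by rewrite [(d + gcdn d 2)%:R]natrD; lra.
have coefQ i : ((1 - 'X) ^+ 3 : {poly rat})`_i = [:: 1; -3; 3; -1]`_i.
  rewrite !exprS expr0 mulr1 !(mulrBl, mul1r, coefB, coefXM, coef1, coefX).
  by case: i => [|[|[|[|i]]]] //=; rewrite nth_nil; lra.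
split; first by rewrite coefQ.
move=> n; rewrite /fps_mul /fps_of_poly /hilbert_series.
under eq_bigr => i _ do rewrite coefQ h_val.
(* From n = 3 on, all four terms of the third difference are present and it
   vanishes on quadratic functions; below, it is truncated. *)
case: n => [|[|[|n]]].
- by rewrite !big_ord_recl big_ord0 !coefE /= subnn; lra.
- by rewrite !big_ord_recl big_ord0 !coefE /= !(subSS, subn0); lra.
- by rewrite !big_ord_recl big_ord0 !coefE /= !(subSS, subn0); lra.
rewrite !big_ord_recl big1 => [|i _]; last by rewrite nth_default // mul0r.
rewrite !coefE /= !(subSS, subn0) -addn3 -addn2 -[n.+1]addn1 !natrD.
by lra.
Qed.
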